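(* Let $(X,d,p)$ be a metric space with a marked point $p$. If all pretangent spaces $\Omega_{p,\tilde r}^{X}$ to $X$ at $p$ (for all normalizing sequences $\tilde r$) are geodesic Busemann convex spaces, then $X$ is Busemann convex at the point $p$.
   Context: Pretangent spaces. Let $(X,d,p)$ be a metric space with marked point $p$. A normalizing sequence is a sequence $\tilde r=\{r_n\}_{n\in\mathbb N}$ of positive reals with $r_n\to 0$. Let $\tilde X$ be the set of all sequences of points of $X$. Two sequences $\tilde x=\{x_n\},\tilde y=\{y_n\}\in\tilde X$ are mutually stable with respect to $\tilde r$ if the finite limit $\tilde d_{\tilde r}(\tilde x,\tilde y):=\lim_{n\to\infty} d(x_n,y_n)/r_n$ exists. A family $\tilde F\subseteq\tilde X$ is self-stable if any two of its elements are mutually stable; it is maximal self-stable if moreover for every $\tilde z\in\tilde X\setminus\tilde F$ there is $\tilde x\in\tilde F$ such that $\tilde x,\tilde z$ are not mutually stable. Let $\tilde X_{p,\tilde r}$ denote a maximal self-stable family (with respect to $\tilde r$) containing the constant sequence $\tilde p=(p,p,\dots)$. Then $(\tilde X_{p,\tilde r},\tilde d_{\tilde r})$ is a pseudometric space; the metric space $(\Omega_{p,\tilde r}^{X},\rho)$ obtained from it by identifying $\tilde x,\tilde y$ whenever $\tilde d_{\tilde r}(\tilde x,\tilde y)=0$, with $\rho$ induced by $\tilde d_{\tilde r}$, is called a pretangent space to $X$ at $p$ with respect to $\tilde r$. (There may be several pretangent spaces for one $\tilde r$, depending on the choice of $\tilde X_{p,\tilde r}$.) Midpoint convexity at $p$.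 $X$ is midpoint convex at $p$ if for any two sequences $\tilde x=\{x_n\}$, $\tilde y=\{y_n\}$ in $X$ converging to $p$ there is a sequence $\tilde z=\{z_n\}$ in $X$ (called an infinitesimal midpoint of $\tilde x,\tilde y$) such that, with $\delta_p(x,y):=\max\{d(x,p),d(y,p)\}$, $$\lim_{n\to\infty}\frac{|d(x_n,z_n)-\frac12 d(x_n,y_n)|}{\delta_p(x_n,y_n)}=\lim_{n\to\infty}\frac{|d(y_n,z_n)-\frac12 d(x_n,y_n)|}{\delta_p(x_n,y_n)}=0,$$ where, when $x_n=y_n=p$, the quotients are understood as $0$ if $z_n=p$ and as $+\infty$ if $z_n\ne p$. Busemann convexity at $p$. $X$ is Busemann convex at $p$ if it is midpoint convex at $p$ and for any sequences $\tilde x^0=\{x_n^0\}$, $\tilde x^1=\{x_n^1\}$, $\tilde y=\{y_n\}$ in $X$ converging to $p$ and any infinitesimal midpoint $\tilde m^x=\{m_n^x\}$ of $\tilde x^0,\tilde x^1$, $$\Bigl(d(m_n^x,y_n)-\tfrac12\bigl(d(x_n^0,y_n)+d(x_n^1,y_n)\bigr)\Bigr)_+=o\bigl(\delta_p(x_n^0,y_n,x_n^1)\bigr),$$ where $(t)_+=\frac{|t|+t}{2}$ and $\delta_p(x_n^0,y_n,x_n^1)=\max\{d(x_n^0,p),d(y_n,p),d(x_n^1,p)\}$. Busemann convex space. A geodesic space $(Y,d)$ is Busemann convex if for any two affinely parametrized geodesics $\gamma:[a,b]\to Y$ and $\gamma':[a',b']\to Y$ the function $(t,t')\mapsto d(\gamma(t),\gamma'(t'))$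 is convex on $[a,b]\times[a',b']$. *)

(* Defs.v *)
From HB Require Import structures.
From mathcomp Require Import all_boot all_order all_algebra generic_quotient.
From mathcomp Require Import all_classical all_reals all_analysis.
Set Implicit Arguments.
Unset Strict Implicit.
Unset Printing Implicit Defensive.
Import Order.TTheory GRing.Theory Num.Theory.
Import numFieldNormedType.Exports.
Local Open Scope classical_set_scope.
Local Open Scope ring_scope.
Local Open Scope quotient_scope.

Record normalizing_seq (R : realType) := NormalizingSeq {
  normalizing_fun :> nat -> R ;
  normalizing_gt0 : forall n, 0 < normalizing_fun n ;
  normalizing_cvg0 : normalizing_fun n @[n --> \oo] --> 0 }.

Section rescaled_distance.
Context {R : realType} {X : metricType R}.
Implicit Types (r : nat -> R) (x y z : nat -> X) (F : set (nat -> X)).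

Definition mutually_stable r x y : Prop :=
  exists l : R, mdist (x n) (y n) / r n @[n --> \oo] --> l.

Definition rescaled_dist r x y : R :=
  lim (mdist (x n) (y n) / r n @[n --> \oo]).

Definition self_stable r F : Prop :=
  forall x y, F x -> F y -> mutually_stable r x y.

Definition maximal_self_stable r F : Prop :=
  self_stable r F /\
  forall z, ~ F z -> exists2 x, F x & ~ mutually_stable r x z.

End rescaled_distance.

Record stable_family (R : realType) (X : metricType R) (p : X)
    (r : normalizing_seq R) := StableFamily {
  family_set : set (nat -> X) ;
  family_maximal : maximal_self_stable r family_set ;
  family_base : family_set (fun=> p) }.

Section pretangent.
Context {R : realType} {X : metricType R} {p : X} {r : normalizing_seq R}.
Variable F : stable_family p r.

Definition family_type : Type := set_type (family_set F).

Definition family_dist (x y : family_type) : R :=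
  rescaled_dist r (\val x) (\val y).

Lemma family_dist_cvg (x y : family_type) :
  mdist (\val x n) (\val y n) / r n @[n --> \oo] --> family_dist x y.
Proof.
have [+ _] := family_maximal F.
move=> /(_ _ _ (set_mem (valP x)) (set_mem (valP y)))[l xyl].
by rewrite /family_dist /rescaled_dist (cvg_lim (@Rhausdorff R) xyl).
Qed.

Lemma family_distxx x : family_dist x x = 0.
Proof.
rewrite -(cvg_lim (@Rhausdorff R) (@family_dist_cvg x x)).
apply: (cvg_lim (@Rhausdorff R)).
by under eq_cvg do rewrite mdistxx mul0r; exact: cvg_cst.
Qed.

Lemma family_dist_sym x y : family_dist x y = family_dist y x.
Proof.
rewrite -(cvg_lim (@Rhausdorff R) (@family_dist_cvg x y)).
apply: (cvg_lim (@Rhausdorff R)).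
by under eq_cvg do rewrite metric_sym; exact: family_dist_cvg.
Qed.

Lemma family_dist_triangle y x z :
  family_dist x z <= family_dist x y + family_dist y z.
Proof.
apply: ler_cvg_to (@family_dist_cvg x z)
  (cvgD (@family_dist_cvg x y) (@family_dist_cvg y z)) _.
apply: nearW => n /=; rewrite -mulrDl ler_pM2r ?invr_gt0 ?normalizing_gt0//.
exact: metric_triangle.
Qed.

Definition family_eqv : rel family_type := fun x y => family_dist x y == 0.

Lemma family_dist_eq0_congr x y z :
  family_eqv x y -> family_dist x z = family_dist y z.
Proof.
move=> /eqP xy0; apply/eqP; rewrite eq_le; apply/andP; split.
  by rewrite (le_trans (family_dist_triangle y _ _))// xy0 add0r.
by rewrite (le_trans (family_dist_triangle x _ _))// family_dist_sym xy0 add0r.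
Qed.

Lemma family_eqv_refl : reflexive family_eqv.
Proof. by move=> x; rewrite /family_eqv family_distxx. Qed.

Lemma family_eqv_sym : symmetric family_eqv.
Proof. by move=> x y; rewrite /family_eqv family_dist_sym. Qed.

Lemma family_eqv_trans : transitive family_eqv.
Proof. by move=> y x z /family_dist_eq0_congr; rewrite /family_eqv => ->. Qed.

Canonical family_equiv_rel :=
  EquivRel family_eqv family_eqv_refl family_eqv_sym family_eqv_trans.

Definition pretangent : Type := {eq_quot family_eqv}.

HB.instance Definition _ := Choice.on pretangent.
HB.instance Definition _ := EqQuotient.on pretangent.

(* Independent of the representatives: see mdist_pretangent. *)
Definition pretangent_dist (a b : pretangent) : R :=
  family_dist (repr a) (repr b).

Lemma pretangent_dist_pi x y :
  pretangent_dist (\pi_pretangent x) (\pi_pretangent y) = family_dist x y.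
Proof.
have piE z : family_eqv (repr (\pi_pretangent z)) z.
  by have := reprK (\pi_pretangent z) => /eqP; rewrite eqmodE.
rewrite /pretangent_dist (family_dist_eq0_congr _ (piE x)).
rewrite family_dist_sym (family_dist_eq0_congr _ (piE y)).
exact: family_dist_sym.
Qed.

Let pretangent_distxx a : pretangent_dist a a = 0.
Proof. exact: family_distxx. Qed.

Let pretangent_dist_eq0 a b : pretangent_dist a b = 0 -> a = b.
Proof.
by move=> /eqP ab0; rewrite -[a]reprK -[b]reprK; apply/eqP; rewrite eqmodE.
Qed.

Let pretangent_dist_sym a b : pretangent_dist a b = pretangent_dist b a.
Proof. exact: family_dist_sym. Qed.

Let pretangent_dist_triangle b a c :
  pretangent_dist a c <= pretangent_dist a b + pretangent_dist b c.
Proof. exact: family_dist_triangle. Qed.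

HB.instance Definition _ := @isMetric.Build R pretangent pretangent_dist
  pretangent_distxx pretangent_dist_eq0 pretangent_dist_sym
  pretangent_dist_triangle.

Lemma mdist_pretangent x y :
  mdist (\pi_pretangent x) (\pi_pretangent y) = family_dist x y.
Proof. exact: pretangent_dist_pi. Qed.

End pretangent.

Section geodesics.
Context {R : realType} (Y : metricType R).

(* A path on [a, b] is a total function whose values outside [a, b] are
   irrelevant. *)
Definition geodesic (a b : R) (gamma : R -> Y) : Prop :=
  a <= b /\ {in `[a, b] &, forall s t, mdist (gamma s) (gamma t) = `|s - t|}.

(* Constant paths (v = 0) are affinely parametrized geodesics. *)
Definition affine_geodesic (a b : R) (gamma : R -> Y) : Prop :=
  a <= b /\ exists2 v : R, 0 <= v &
    {in `[a, b] &, forall s t, mdist (gamma s) (gamma t) = v * `|s - t|}.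

Definition geodesic_space : Prop :=
  forall x y : Y, exists a b gamma,
    [/\ geodesic a b gamma, gamma a = x & gamma b = y].

Definition busemann_convex : Prop :=
  forall (a b : R) (gamma : R -> Y) (a' b' : R) (gamma' : R -> Y),
    affine_geodesic a b gamma -> affine_geodesic a' b' gamma' ->
    convex_function (E := (R^o * R^o)%type) (`[a, b] `*` `[a', b'])
      (fun u => mdist (gamma u.1) (gamma' u.2)).

End geodesics.

Section convexity_at.
Context {R : realType} {X : metricType R} (p : X).
Implicit Types x y z m : nat -> X.

Definition delta2 (x y : X) : R := Num.max (mdist x p) (mdist y p).

Definition delta3 (x y z : X) : R :=
  Num.max (Num.max (mdist x p) (mdist y p)) (mdist z p).

(* The denominator vanishes exactly when x = y = p; the quotient is then 0 or
   +oo by convention, whence the extended reals. *)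
Definition midpoint_defect (x y z : X) : \bar R :=
  if (x == p) && (y == p) then (if z == p then 0 else +oo)%E
  else (`|mdist x z - mdist x y / 2| / delta2 x y)%:E.

(* Swapping x and y in the defect leaves d(x, y) and delta2 unchanged. *)
Definition infinitesimal_midpoint x y z : Prop :=
  midpoint_defect (x n) (y n) (z n) @[n --> \oo] --> 0%E /\
  midpoint_defect (y n) (x n) (z n) @[n --> \oo] --> 0%E.

Definition midpoint_convex_at : Prop :=
  forall x y, x n @[n --> \oo] --> p -> y n @[n --> \oo] --> p ->
    exists z, infinitesimal_midpoint x y z.

Definition pos_part (t : R) : R := (`|t| + t) / 2.

Definition busemann_convex_at : Prop :=
  midpoint_convex_at /\
  forall x0 x1 y m,
    x0 n @[n --> \oo] --> p -> x1 n @[n --> \oo] --> p ->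
    y n @[n --> \oo] --> p -> infinitesimal_midpoint x0 x1 m ->
    (fun n => pos_part
       (mdist (m n) (y n) - (mdist (x0 n) (y n) + mdist (x1 n) (y n)) / 2))
    =o_\oo (fun n => delta3 (x0 n) (y n) (x1 n)).

End convexity_at.

(* Main.v *)
(* If one of the defining relations failed along infinitely many n, rescale
   these n by delta_p: the finitely many sequences involved have bounded mutual
   distances, so along a further subsequence they are mutually stable and lie in
   a common maximal self-stable family. Their classes in the corresponding
   pretangent space then contradict, respectively, the existence of midpoints
   and the inequality d(m, y) <= (d(x0, y) + d(x1, y)) / 2. The latter comes
   from Busemann convexity because geodesics from x0 to m and from m to x1
   concatenate to a geodesic when m is a midpoint of x0, x1. *)
Require Import Defs.
From mathcomp Require Import all_boot all_order all_algebra generic_quotient.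
From mathcomp Require Import all_classical all_reals all_analysis.
From mathcomp Require Import ring lra.
Set Implicit Arguments.
Unset Strict Implicit.
Unset Printing Implicit Defensive.
Import Order.TTheory GRing.Theory Num.Theory.
Import numFieldNormedType.Exports.
Local Open Scope classical_set_scope.
Local Open Scope ring_scope.
Local Open Scope quotient_scope.

(** * Limits along ultrafilters *)

Lemma ultra_fmap (T U : Type) (f : T -> U) (G : set_system T) :
  UltraFilter G -> UltraFilter (f @ G).
Proof.
move=> UG; split=> [|H HP GH]; first exact: fmap_proper_filter.
apply/seteqP; split=> [A HA|]; last exact: GH.
have [//|GnA] := in_ultra_setVsetC (f @^-1` A) UG.
have HnA : H (~` A) by apply: GH.
by have [x []] := filter_ex (filterI HA HnA).
Qed.

(** Compactness of [[a, b]] in ultrafilter form: the image ultrafilter contains the segment, hence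
    converges in it. This stands in for extracting convergent subsequences one after another. *)
Lemma ultra_cvg_bounded (R : realType) (T : Type) (G : set_system T)
    (f : T -> R) (a b : R) :
  UltraFilter G -> (\forall n \near G, a <= f n <= b) ->
  exists l : R, f n @[n --> G] --> l.
Proof.
move=> UG fab; have := @segment_compact R a b; rewrite compact_ultra.
have fG : (f @ G) `[a, b]%classic.
  by apply: filterS fab => n /= fn; rewrite in_itv.
by move=> /(_ _ (ultra_fmap f UG) fG)[l [_ fl]]; exists l.
Qed.

Lemma cvg_infty_ge (f : nat -> nat) :
  (forall k, (k <= f k)%N) -> f k @[k --> \oo] --> \oo.
Proof.
move=> f_ge A [N _ NA]; exists N => // k /= Nk.
by apply: NA => /=; exact: leq_trans Nk (f_ge k).
Qed.

(** * Maximal self-stable families and simultaneous stabilization along a subsequence *)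

Section stable_families.
Context {R : realType} {X : metricType R}.
Implicit Types (x y z : nat -> X) (S : set (nat -> X)).

Lemma mutually_stable_sym (r : nat -> R) x y :
  mutually_stable r x y -> mutually_stable r y x.
Proof. by case=> l xyl; exists l; under eq_cvg do rewrite metric_sym. Qed.

Lemma mutually_stable_refl (r : nat -> R) x : mutually_stable r x x.
Proof.
by exists 0; under eq_cvg do rewrite mdistxx mul0r; exact: cvg_cst.
Qed.

(** Zorn's lemma, applied to the sets [A] for which [A] together with [S] is self-stable. Keeping
    [S] outside [A] makes the union of the empty chain admissible as well. *)
Lemma stable_family_extension (p : X) (r : normalizing_seq R) S :
  self_stable r S -> S (fun=> p) ->
  exists F : stable_family p r, S `<=` family_set F.
Proof.
move=> SS Sp.
have [C CP totC|A [stA maxA]] :=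
    @Zorn_bigcup (nat -> X) (fun A => self_stable r (A `|` S)).
  move=> x y [[A CA Ax]|Sx] [[B CB By]|Sy].
  - have [AB|BA] := totC _ _ CA CB.
    + by apply: (CP _ CB); left => //; exact: AB.
    + by apply: (CP _ CA); left => //; exact: BA.
  - by apply: (CP _ CA); [left|right].
  - by apply: (CP _ CB); [right|left].
  - exact: SS.
have maxAS : maximal_self_stable r (A `|` S).
  split=> // z nASz; apply: contrapT => nst.
  have stz x : (A `|` S) x -> mutually_stable r x z.
    by move=> ASx; apply: contrapT => nxz; apply: nst; exists x.
  (* A sequence [z] outside the family but stable with all its members could be added to [A],
     against maximality. *)
  apply: (maxA (z |` A)).
    split; first by move=> x Ax; right.
    by move=> zA; apply: nASz; left; apply: zA; left.
  rewrite -setUA => x y [->|ASx] [->|ASy].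
  - exact: mutually_stable_refl.
  - by apply: mutually_stable_sym; exact: stz.
  - exact: stz.
  - exact: stA.
by exists (StableFamily maxAS (or_intror Sp)) => x Sx; right.
Qed.

(* An ultrafilter finer than \oo that contains B makes all the finitely many
   rescaled distances converge at once. *)
Lemma stable_subsequence (p : X) (I : finType) (u : I -> nat -> X) (i0 : I)
    (delta : nat -> R) (C : R) (B : set nat) :
  u i0 = (fun=> p) -> delta n @[n --> \oo] --> 0 ->
  (forall k, exists2 n, (k <= n)%N & B n) ->
  (\forall n \near \oo, B n ->
    0 < delta n /\ forall i, mdist (u i n) p <= C * delta n) ->
  exists f : nat -> nat, [/\ forall k, (k <= f k)%N, forall k, B (f k) &
    exists r : normalizing_seq R, (forall k, r k = delta (f k)) /\
    exists F : stable_family p r, forall i, family_set F (u i \o f)].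
Proof.
move=> ui0 delta0 Binf Bdelta.
(* Properness is exactly the assumption that [B] contains arbitrarily large indices. *)
have BP : ProperFilter (within B \oo).
  split; last exact: within_filter.
  move=> -[N _ NB]; have [n Nn Bn] := Binf N.
  exact: (NB n Nn Bn).
have [G [UG BG]] := ultraFilterLemma BP.
have ooG : \oo `<=` G by move=> A ooA; apply: BG; exact: filterS ooA.
have GB : G B by apply: BG; exact: nearW.
have GBd : \forall n \near G,
    0 < delta n /\ forall i, mdist (u i n) p <= C * delta n.
  by apply: BG.
pose a (ij : I * I) n := mdist (u ij.1 n) (u ij.2 n) / delta n.
have /choice[l al] : forall ij, exists l : R, a ij n @[n --> G] --> l.
  (* The bound [C + C] comes from the triangle inequality through [p]. *)
  move=> ij; apply: (@ultra_cvg_bounded _ _ _ _ 0 (C + C)).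
  apply: filterS GBd => n [d0 dC].
  rewrite divr_ge0 ?mdist_ge0 ?(ltW d0)//= ler_pdivrMr//.
  rewrite (le_trans (metric_triangle _ p _))// mulrDl lerD//.
  by rewrite metric_sym.
(* Back from the ultrafilter to a sequence: finitely many pairs allow one index to serve them all
   with error below 1/(k+1). Monotonicity of [f] is not asked for, since [k <= f k] already makes it
   tend to infinity. *)
have /choice[f fP] : forall k, exists n, [/\ (k <= n)%N, B n, 0 < delta n &
    forall ij, `|l ij - a ij n| < k.+1%:R^-1].
  move=> k; apply: (@filter_ex _ G).
  have kG : G [set n | (k <= n)%N] by apply: ooG; exact: nbhs_infty_ge.
  have lG : \forall n \near G, forall ij, `|l ij - a ij n| < k.+1%:R^-1.
    by apply: filter_forall => ij; apply: (cvgrPdist_lt _ _).1 (al ij) _ _.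
  near=> n; split; near: n => //.
  by apply: filterS GBd => n [].
have f_oo : f k @[k --> \oo] --> \oo.
  by apply: cvg_infty_ge => k; have [] := fP k.
exists f; split=> [k|k|]; [by have [] := fP k|by have [] := fP k|].
have r0 k : 0 < delta (f k) by have [] := fP k.
have rcvg : delta (f k) @[k --> \oo] --> 0 by exact: cvg_comp f_oo delta0.
exists (NormalizingSeq r0 rcvg); split=> //.
have afl ij : a ij (f k) @[k --> \oo] --> l ij.
  apply/cvgrPdist_lt => e e0.
  have := near_infty_natSinv_lt (PosNum e0).
  by apply: filterS => k /=; apply: lt_trans; have [] := fP k.
have [x y [i _ <-] [j _ <-]||F SF] :=
  @stable_family_extension p (NormalizingSeq r0 rcvg)
    (range (fun i => u i \o f)).
- by exists (l (i, j)); exact: afl.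
- by exists i0 => //; rewrite ui0.
- by exists F => i; apply: SF; exists i.
Unshelve. all: by end_near. Qed.

End stable_families.

(** * Points of a pretangent space as classes of sequences *)

Section pretangent_points.
Context {R : realType} {X : metricType R} {p : X} {r : normalizing_seq R}.
Variable F : stable_family p r.
Implicit Types (x y z : nat -> X).

Definition family_point x (Fx : family_set F x) : pretangent F :=
  \pi_(pretangent F) (exist _ x (mem_set Fx) : family_type F).

Lemma family_point_cvg x y (Fx : family_set F x) (Fy : family_set F y) :
  mdist (x n) (y n) / r n @[n --> \oo] -->
  mdist (family_point Fx) (family_point Fy).
Proof. by rewrite mdist_pretangent; exact: family_dist_cvg. Qed.

Lemma family_point_surj (a : pretangent F) :
  exists x (Fx : family_set F x), a = family_point Fx.
Proof.
exists (\val (repr a)), (set_mem (valP (repr a))).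
rewrite -[LHS]reprK /family_point; congr (\pi_(_) _).
exact/val_inj.
Qed.

End pretangent_points.

Arguments family_point_cvg {R X p r F x y} Fx Fy.

(** * Geodesics, midpoints and Busemann convexity in a metric space *)

Section geodesic_lemmas.
Context {R : realType} {Y : metricType R}.
Implicit Types x y m : Y.

Lemma geodesic_from0 x y : geodesic_space Y ->
  exists gamma, [/\ geodesic 0 (mdist x y) gamma, gamma 0 = x
    & gamma (mdist x y) = y].
Proof.
move=> /(_ x y)[a [b [gamma [[ab iso] ga gb]]]].
have dE : mdist x y = b - a.
  by rewrite -ga -gb iso ?bound_itvE// distrC ger0_norm// subr_ge0.
exists (fun t => gamma (a + t)); rewrite dE; split; last 2 first.
- by rewrite addr0.
- by rewrite addrC subrK.
split; first by rewrite subr_ge0.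
move=> s t; rewrite !in_itv/= => sb tb.
rewrite iso ?in_itv/=; [|lra..].
by congr (`| _ |); ring.
Qed.

Lemma geodesic_space_midpoint x y : geodesic_space Y ->
  exists m, mdist x m = mdist x y / 2 /\ mdist y m = mdist x y / 2.
Proof.
move=> /(geodesic_from0 x y)[g [[d0 iso] g0 gd]].
exists (g (mdist x y / 2)); split; [rewrite -{1}g0|rewrite -{1}gd].
all: rewrite iso ?in_itv/=; [|lra..].
- by rewrite sub0r normrN ger0_norm//; lra.
- by rewrite ger0_norm; lra.
Qed.

Lemma geodesic_through_midpoint x y m : geodesic_space Y ->
  mdist x m = mdist x y / 2 -> mdist y m = mdist x y / 2 ->
  exists gamma, [/\ geodesic 0 (mdist x y) gamma, gamma 0 = x,
    gamma (mdist x y / 2) = m & gamma (mdist x y) = y].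
Proof.
move=> geoY xm ym.
have [g [[h0 giso] g0 gh]] := geodesic_from0 x m geoY.
have [g' [[_ g'iso] g'0 g'h]] := geodesic_from0 m y geoY.
have my : mdist m y = mdist x y / 2 by rewrite metric_sym.
rewrite xm in giso gh h0; rewrite my in g'iso g'h.
set h := mdist x y / 2 in giso gh h0 g'iso g'h *.
have dE : mdist x y = h + h by rewrite /h; lra.
exists (fun t => if t <= h then g t else g' (t - h)).
split; [|by rewrite h0| by rewrite lexx|]; last first.
  (* At the right end the first branch is taken only if [h = 0], and then [x], [m] and [y]
     coincide. *)
  rewrite dE; case: ifPn => [|_]; last by rewrite addrK.
  rewrite gerDl => h_le0; have h00 : h = 0 by lra.
  by move: g'h gh; rewrite h00 addr0 g'0 => -> ->.
split; first by rewrite mdist_ge0.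
(* Passing through [m] gives at most [t - s]. A smaller distance would make the route from [x] via
   the two points to [y] shorter than [mdist x y]. *)
have cross s t : 0 <= s -> s <= h -> h < t -> t <= h + h ->
    mdist (g s) (g' (t - h)) = t - s.
  move=> s0 sh ht th.
  have d1 : mdist (g s) m = h - s.
    by rewrite -gh giso ?in_itv/= ?s0 ?h0 ?lexx// distrC ger0_norm// subr_ge0.
  have d2 : mdist m (g' (t - h)) = t - h.
    rewrite -g'0 g'iso ?in_itv/=; [|lra..].
    by rewrite sub0r normrN ger0_norm//; lra.
  have d3 : mdist x (g s) = s.
    rewrite -g0 giso ?in_itv/=; [|lra..].
    by rewrite sub0r normrN ger0_norm.
  have d4 : mdist (g' (t - h)) y = h + h - t.
    rewrite -g'h g'iso ?in_itv/=; [|lra..].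
    by rewrite distrC ger0_norm; lra.
  have := metric_triangle (g s) m (g' (t - h)).
  have := metric_triangle x (g s) y.
  have := metric_triangle (g s) (g' (t - h)) y.
  rewrite d1 d2 d3 d4 dE; lra.
move=> s t; rewrite !in_itv/= dE => /andP[s0 sh] /andP[t0 th].
case: (leP s h) => hs; case: (leP t h) => ht.
- by rewrite giso// in_itv/= ?s0 ?t0.
- by rewrite cross// distrC ger0_norm//; lra.
- by rewrite metric_sym cross// ger0_norm//; lra.
- rewrite g'iso ?in_itv/=; [|lra..].
  by congr (`| _ |); ring.
Qed.

(** Convexity is applied with weight 1/2 to a geodesic from [x0] through [m] to [x1] and to the
    constant path at [y] on the degenerate interval [0, 0]. *)
Lemma busemann_convex_midpoint x0 x1 m y :
  geodesic_space Y -> busemann_convex Y ->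
  mdist x0 m = mdist x0 x1 / 2 -> mdist x1 m = mdist x0 x1 / 2 ->
  mdist m y <= (mdist x0 y + mdist x1 y) / 2.
Proof.
move=> geoY convY x0m x1m.
have [g [[d0 giso] g0 gm g1]] := geodesic_through_midpoint geoY x0m x1m.
have gaff : affine_geodesic 0 (mdist x0 x1) g.
  by split=> //; exists 1 => // s t sI tI; rewrite mul1r giso.
have yaff : affine_geodesic 0 0 (fun=> y).
  by split=> //; exists 0 => // s t _ _; rewrite mdistxx mul0r.
have inI z : 0 <= z <= mdist x0 x1 ->
    ((z, 0) : R * R) \in `[0, mdist x0 x1]%classic `*` `[0, 0]%classic.
  by move=> zI; rewrite inE; split => /=; rewrite in_itv/= ?lexx.
have half_le1 : (2^-1 : R) <= 1 by lra.
have half_ge0 : 0 <= (2^-1 : R) by lra.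
have := convY _ _ _ _ _ _ gaff yaff (Itv01 half_ge0 half_le1)
  (0, 0) (mdist x0 x1, 0).
rewrite convRE/=.
have -> : 2^-1 *: 0 + unstable.onem 2^-1 *: mdist x0 x1 = mdist x0 x1 / 2 :> R.
  by rewrite scaler0 add0r /GRing.scale/= /unstable.onem; lra.
rewrite gm g0 g1 /unstable.onem => /(_ (inI 0 _) (inI _ _)) convm.
by apply: le_trans (convm _ _) _; [rewrite lexx|rewrite d0 lexx|lra].
Qed.

End geodesic_lemmas.

(** * Choosing one sequence for all tolerances; negating eventual statements *)

(** For each [n], take a point that is almost optimal: its tolerance exceeds the infimum of the
    achievable ones by at most 1/(n+1). The infimum need not be attained, and [z0] serves where no
    tolerance is achievable. *)
Lemma near_uniform_choice (R : realType) (T : Type) (z0 : T)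
    (P : nat -> R -> T -> Prop) :
  (forall n e e' z, e <= e' -> P n e z -> P n e' z) ->
  (forall e, 0 < e -> \forall n \near \oo, exists z, P n e z) ->
  exists z : nat -> T, forall e, 0 < e -> \forall n \near \oo, P n e (z n).
Proof.
move=> Pmono Pnear; pose S n := [set e : R | 0 < e /\ exists z, P n e z].
have Slb n : has_lbound (S n) by exists 0 => e [/ltW].
have /choice[z zP] : forall n, exists z, S n !=set0 ->
    P n (inf (S n) + n.+1%:R^-1) z.
  move=> n; have [S0|/nonemptyPn->] := pselect (S n !=set0); last first.
    by exists z0 => -[].
  have [||e [e0 [z Pz]] /ltW eS] := @inf_adherent _ (S n) n.+1%:R^-1.
  - by rewrite invr_gt0.
  - by split.
  - by exists z => _; apply: Pmono Pz.
exists z => e e0.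
(* Half of [e] bounds the infimum, the other half bounds 1/(n+1). *)
have e20 : 0 < e / 2 by rewrite divr_gt0.
near=> n.
have Se : S n (e / 2) by split=> //; near: n; exact: Pnear.
apply: Pmono (zP n _); last by exists (e / 2).
rewrite [leRHS](splitr e) lerD ?ge_inf//.
by apply/ltW; near: n; exact: near_infty_natSinv_lt (PosNum e20).
Unshelve. all: by end_near. Qed.

Lemma infinitely_often (P : nat -> Prop) :
  ~ (\forall n \near \oo, P n) -> forall k, exists2 n, (k <= n)%N & ~ P n.
Proof.
move=> nP k; apply: contrapT => nk; apply: nP; exists k => // n /= kn.
by apply: contrapT => nPn; apply: nk; exists n.
Qed.

(** * Midpoint equalities in the limit versus estimates of order o(r) along the sequence *)

Section rescaled_midpoint.
Context {R : realType} {a b : nat -> R} {r : normalizing_seq R} {la lb : R}.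
Hypothesis ala : a n / r n @[n --> \oo] --> la.
Hypothesis blb : b n / r n @[n --> \oo] --> lb.

Let diff_cvg : (a n - b n / 2) / r n @[n --> \oo] --> la - lb / 2.
Proof.
rewrite (_ : (fun n => _) = (fun n => a n / r n - b n / r n * 2^-1)); last first.
  by apply/funext => n; rewrite mulrBl mulrAC.
by apply: cvgB => //; exact: cvgMl.
Qed.

Lemma rescaled_midpoint_near : la = lb / 2 ->
  forall e, 0 < e -> \forall n \near \oo, `|a n - b n / 2| <= e * r n.
Proof.
move=> lab e e0; move/cvgrPdist_le : diff_cvg => /(_ _ e0).
apply: filterS => n; rewrite lab subrr sub0r normrN normrM normfV.
by rewrite (gtr0_norm (normalizing_gt0 r n)) ler_pdivrMr ?normalizing_gt0.
Qed.

Lemma rescaled_midpoint_lim :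
  (forall e, 0 < e -> \forall n \near \oo, `|a n - b n / 2| <= e * r n) ->
  la = lb / 2.
Proof.
move=> near_ab; apply/eqP; rewrite -subr_eq0; apply/eqP.
apply: cvg_unique diff_cvg _ => //; apply/cvgrPdist_le => e /near_ab.
apply: filterS => n; rewrite sub0r normrN normrM normfV.
by rewrite (gtr0_norm (normalizing_gt0 r n)) ler_pdivrMr ?normalizing_gt0.
Qed.

End rescaled_midpoint.

(** * Infinitesimal midpoints in epsilon form *)

Section convexity_at_lemmas.
Context {R : realType} {X : metricType R} (p : X).
Implicit Types (x y z : X) (u v w : nat -> X).

Lemma delta2_ge0 x y : 0 <= delta2 p x y.
Proof. by rewrite le_max mdist_ge0. Qed.

Lemma delta2_le0 x y : delta2 p x y <= 0 -> x = p /\ y = p.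
Proof.
rewrite ge_max => /andP[xp yp].
by split; apply: mdist_positivity; apply: le_anti; rewrite mdist_ge0 ?xp ?yp.
Qed.

Lemma delta2C x y : delta2 p x y = delta2 p y x.
Proof. exact: maxC. Qed.

Lemma delta2_le3 x y z : delta2 p x z <= delta3 p x y z.
Proof. by rewrite /delta2 /delta3 ge_max !le_max !lexx !orbT. Qed.

Lemma delta3_ge0 x y z : 0 <= delta3 p x y z.
Proof. by rewrite !le_max mdist_ge0. Qed.

Lemma mdist_cvg0 u : u n @[n --> \oo] --> p -> mdist (u n) p @[n --> \oo] --> 0.
Proof.
move=> up; apply/cvgrPdist_lt => e e0.
move: up => /metricType_numDomainType.cvgrPdist_lt/(_ _ e0).
by apply: filterS => n; rewrite sub0r normrN ger0_norm ?mdist_ge0// metric_sym.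
Qed.

Lemma max_cvg0 (a b : nat -> R) : a n @[n --> \oo] --> 0 ->
  b n @[n --> \oo] --> 0 -> Num.max (a n) (b n) @[n --> \oo] --> 0.
Proof.
move=> /cvgr0_norm_lt a0 /cvgr0_norm_lt b0; apply/cvgrPdist_lt => e e0.
near=> n; rewrite sub0r normrN /Num.max; case: ifPn => _; near: n.
- exact: b0.
- exact: a0.
Unshelve. all: by end_near. Qed.

Lemma delta2_cvg0 u v : u n @[n --> \oo] --> p -> v n @[n --> \oo] --> p ->
  delta2 p (u n) (v n) @[n --> \oo] --> 0.
Proof. by move=> up vp; apply: max_cvg0; exact: mdist_cvg0. Qed.

Lemma delta3_cvg0 u v w : u n @[n --> \oo] --> p -> v n @[n --> \oo] --> p ->
  w n @[n --> \oo] --> p -> delta3 p (u n) (v n) (w n) @[n --> \oo] --> 0.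
Proof.
move=> up vp wp; apply: max_cvg0; last exact: mdist_cvg0.
by apply: max_cvg0; exact: mdist_cvg0.
Qed.

Lemma midpoint_defect_ge0 x y z : (0 <= midpoint_defect p x y z)%E.
Proof.
rewrite /midpoint_defect; case: ifPn => _; first by case: ifPn.
by rewrite lee_fin divr_ge0 ?delta2_ge0.
Qed.

(** Clearing the denominator absorbs the convention for [x = y = p]: the right-hand side then reads
    [mdist p z <= 0], which holds exactly when [z = p], that is, when the defect is 0 and not
    +oo. *)
Lemma midpoint_defect_le x y z (e : R) : 0 <= e ->
  (midpoint_defect p x y z <= e%:E)%E =
  (`|mdist x z - mdist x y / 2| <= e * delta2 p x y).
Proof.
move=> e0; rewrite /midpoint_defect; case: ifPn => [/andP[/eqP-> /eqP->]|nxy].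
  rewrite /delta2 !mdistxx maxxx mulr0 mul0r subr0 normr_le0.
  case: ifPn => [/eqP->|zp]; first by rewrite lee_fin e0 mdistxx eqxx.
  rewrite leye_eq/=; apply/esym/negbTE; apply: contra zp => /eqP pz.
  by rewrite (mdist_positivity _ _ pz).
rewrite lee_fin ler_pdivrMr// lt_neqAle delta2_ge0 andbT.
apply: contra nxy => /eqP d0.
have [|-> ->] := @delta2_le0 x y; last by rewrite !eqxx.
by rewrite -d0.
Qed.

Lemma midpoint_defect_cvg0 u v w :
  midpoint_defect p (u n) (v n) (w n) @[n --> \oo] --> 0%E <->
  forall e, 0 < e -> \forall n \near \oo,
    `|mdist (u n) (w n) - mdist (u n) (v n) / 2| <= e * delta2 p (u n) (v n).
Proof.
split=> [/fine_cvgP[fin /cvgrPdist_le d0] e e0|near0].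
  near=> n; rewrite -(midpoint_defect_le _ _ _ (ltW e0)).
  have fn : midpoint_defect p (u n) (v n) (w n) \is a fin_num by near: n.
  rewrite -(fineK fn) lee_fin.
  have : `|0 - fine (midpoint_defect p (u n) (v n) (w n))| <= e.
    by near: n; exact: d0.
  by rewrite sub0r normrN ger0_norm// fine_ge0// midpoint_defect_ge0.
have fin e : 0 < e -> \forall n \near \oo,
    (0 <= midpoint_defect p (u n) (v n) (w n) <= e%:E)%E.
  move=> e0; apply: filterS (near0 _ e0) => n.
  by rewrite midpoint_defect_ge0 (midpoint_defect_le _ _ _ (ltW e0)).
apply/fine_cvgP; split.
  apply: filterS (fin _ ltr01) => n /andP[d0 d1].
  by rewrite ge0_fin_numE// (le_lt_trans d1) ?ltry.
apply/cvgrPdist_le => e /fin; apply: filterS => n /= /andP[d0 de].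
rewrite sub0r normrN ger0_norm ?fine_ge0//.
by rewrite -lee_fin fineK// ge0_fin_numE// (le_lt_trans de) ?ltry.
Unshelve. all: by end_near. Qed.

Lemma infinitesimal_midpointP u v w : infinitesimal_midpoint p u v w <->
  forall e, 0 < e -> \forall n \near \oo,
    `|mdist (u n) (w n) - mdist (u n) (v n) / 2| <= e * delta2 p (u n) (v n) /\
    `|mdist (v n) (w n) - mdist (u n) (v n) / 2| <= e * delta2 p (u n) (v n).
Proof.
split=> [[/midpoint_defect_cvg0 uw /midpoint_defect_cvg0 vw] e e0|uvw].
  apply: filterS2 (uw _ e0) (vw _ e0) => n.
  by rewrite [mdist (v n) (u n)]metric_sym (delta2C (v n)).
split; apply/midpoint_defect_cvg0 => e /uvw; apply: filterS => n [] //.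
by rewrite [mdist (v n) (u n)]metric_sym (delta2C (v n)).
Qed.

End convexity_at_lemmas.

(** * Midpoint convexity and Busemann convexity at the marked point *)

Lemma midpoint_convex_at_pretangent (R : realType) (X : metricType R) (p : X) :
  (forall (r : normalizing_seq R) (F : stable_family p r),
    geodesic_space (pretangent F)) -> midpoint_convex_at p.
Proof.
move=> geoF x y xp yp.
pose P n e z :=
  `|mdist (x n) z - mdist (x n) (y n) / 2| <= e * delta2 p (x n) (y n) /\
  `|mdist (y n) z - mdist (x n) (y n) / 2| <= e * delta2 p (x n) (y n).
have [n e e' z ee' [Px Py]|e e0|z zP] := @near_uniform_choice R X p P.
- by split; [apply: le_trans Px _|apply: le_trans Py _];
    rewrite ler_wpM2r ?delta2_ge0.
(* The bad indices are those where no point of X is a midpoint up to [e]. *)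
- apply: contrapT => /infinitely_often often.
  pose u i := match i with
    | None => fun=> p | Some true => x | Some false => y end.
  have [|f [_ fB [r [rE [F Fu]]]]] :=
      @stable_subsequence R X p _ u None _ 1 _ erefl
        (delta2_cvg0 xp yp) often.
    apply: nearW => n nP; split.
      (* The scale is positive at a bad index: if both points were [p], then [p] itself would be a
         midpoint. *)
      rewrite ltNge; apply/negP => /delta2_le0[xnp ynp].
      by apply: nP; exists p; rewrite /P xnp ynp mdistxx mul0r subr0 normr0
        mulr_ge0 ?delta2_ge0 ?ltW.
    case=> [[]|] /=; rewrite mul1r ?mdistxx ?delta2_ge0//.
      by rewrite le_max lexx.
    by rewrite le_max lexx orbT.
  have Fx := Fu (Some true); have Fy := Fu (Some false).
  have [m [xm ym]] :=
    geodesic_space_midpoint (family_point Fx) (family_point Fy) (geoF r F).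
  have [z [Fz mz]] := family_point_surj m; subst m.
  have xyD := family_point_cvg Fx Fy.
  (* A sequence representing the midpoint of the two classes is eventually an [e]-midpoint at scale
     [r], so a single index contradicts badness. *)
  have xz := rescaled_midpoint_near (family_point_cvg Fx Fz) xyD xm e0.
  have yz := rescaled_midpoint_near (family_point_cvg Fy Fz) xyD ym e0.
  have [k [xzk yzk]] := filter_ex (filterI xz yz).
  by apply: (fB k); exists (z k); rewrite /P -rE.
by exists z; apply/infinitesimal_midpointP.
Qed.

Theorem mainTheorem6 (R : realType) (X : metricType R) (p : X)
  (pretangent_busemann :
     forall (r : normalizing_seq R) (F : stable_family p r),
       geodesic_space (pretangent F) /\ busemann_convex (pretangent F)) :
  busemann_convex_at p.
Proof.
split.
  apply: midpoint_convex_at_pretangent => r F.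
  by have [] := pretangent_busemann r F.
move=> x0 x1 y m x0p x1p yp /infinitesimal_midpointP mid.
apply/eqoP => e e0; apply: contrapT => /infinitely_often often.
pose delta n := delta3 p (x0 n) (y n) (x1 n).
pose u i := match i with
  | None => fun=> p
  | Some (true, true) => x0 | Some (true, false) => x1
  | Some (false, true) => y | Some (false, false) => m end.
have x0_le n : mdist (x0 n) p <= delta n by rewrite !le_max lexx.
have x1_le n : mdist (x1 n) p <= delta n by rewrite !le_max lexx !orbT.
have y_le n : mdist (y n) p <= delta n by rewrite !le_max lexx !orbT.
have d_ge0 n : 0 <= delta n by exact: delta3_ge0.
(* The constant 3 is needed for [m] only: [mdist (x0 n) (m n)] is at most [2 * delta n] by the
   midpoint estimate with tolerance 1, and [mdist (x0 n) p] adds one more [delta n]. *)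
have [|f [f_ge fB [r [rE [F Fu]]]]] :=
    @stable_subsequence R X p _ u None delta 3 _ erefl
      (delta3_cvg0 x0p yp x1p) often.
  apply: filterS (mid _ ltr01) => n; rewrite mul1r => -[x0m _] bad.
  have x0x1 := metric_triangle (x0 n) p (x1 n).
  rewrite [mdist p _]metric_sym in x0x1.
  have := delta2_le3 p (x0 n) (y n) (x1 n); rewrite -/(delta n) => d23.
  have x0m_le : mdist (x0 n) (m n) <= 2 * delta n.
    move: x0m (x0_le n) (x1_le n); rewrite ler_norml => /andP[_]; lra.
  split; last first.
    have mp := metric_triangle (m n) (x0 n) p.
    rewrite [mdist (m n) (x0 n)]metric_sym in mp.
    by case=> [[[] []]|] /=; rewrite ?mdistxx;
      move: (x0_le n) (x1_le n) (y_le n) (d_ge0 n); lra.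
  (* If [delta n] vanished, all four points would equal [p], and the inequality said to fail at [n]
     would read [0 <= 0]. *)
  rewrite ltNge; apply/negP => dn0; apply: bad.
  have toP z : mdist z p <= delta n -> z = p.
    move=> zd; apply: mdist_positivity; apply: le_anti.
    by rewrite mdist_ge0 (le_trans zd dn0).
  have x0n := toP _ (x0_le n); have x1n := toP _ (x1_le n).
  have yn := toP _ (y_le n).
  have mn : p = m n.
    apply: mdist_positivity; apply: le_anti; rewrite mdist_ge0 andbT.
    by rewrite -{1}x0n (le_trans x0m_le)//; lra.
  rewrite x0n x1n yn -mn /pos_part mdistxx addr0 mul0r subr0 normr0 addr0 mul0r.
  by rewrite normr0 mulr_ge0// ltW.
have Fx0 := Fu (Some (true, true)); have Fx1 := Fu (Some (true, false)).
have Fy := Fu (Some (false, true)); have Fm := Fu (Some (false, false)).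
have f_oo := cvg_infty_ge f_ge.
have midf e' : 0 < e' -> \forall k \near \oo,
    `|mdist (x0 (f k)) (m (f k)) - mdist (x0 (f k)) (x1 (f k)) / 2|
      <= e' * r k /\
    `|mdist (x1 (f k)) (m (f k)) - mdist (x0 (f k)) (x1 (f k)) / 2|
      <= e' * r k.
  move=> e'0.
  apply: (@filterS _ \oo _ _ _ _ (f_oo _ (mid _ e'0))) => k [x0m x1m].
  (* Midpoint errors are measured against [delta2], which is dominated by the normalizing scale
     [delta3]; so they vanish after rescaling. *)
  have d23 : e' * delta2 p (x0 (f k)) (x1 (f k)) <= e' * r k.
    by rewrite rE ler_pM2l// delta2_le3.
  by split; exact: le_trans d23.
have x0x1D := family_point_cvg Fx0 Fx1.
have x0m : mdist (family_point Fx0) (family_point Fm) =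
    mdist (family_point Fx0) (family_point Fx1) / 2.
  apply: rescaled_midpoint_lim (family_point_cvg Fx0 Fm) x0x1D _ => e' /midf.
  by apply: filterS => k [].
have x1m : mdist (family_point Fx1) (family_point Fm) =
    mdist (family_point Fx0) (family_point Fx1) / 2.
  apply: rescaled_midpoint_lim (family_point_cvg Fx1 Fm) x0x1D _ => e' /midf.
  by apply: filterS => k [].
have [geo conv] := pretangent_busemann r F.
have := busemann_convex_midpoint (family_point Fy) geo conv x0m x1m.
(* The rescaled excess is at least [e] at every index of the subsequence, hence so is its limit, the
   excess in the pretangent space. *)
apply/negP; rewrite -ltNge -subr_gt0; apply: lt_le_trans (e0) _.
have tcvg : mdist (m (f k)) (y (f k)) / r k -
    (mdist (x0 (f k)) (y (f k)) / r k + mdist (x1 (f k)) (y (f k)) / r k) / 2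
    @[k --> \oo] -->
    mdist (family_point Fm) (family_point Fy) -
    (mdist (family_point Fx0) (family_point Fy) +
     mdist (family_point Fx1) (family_point Fy)) / 2.
  apply: cvgB; first exact: family_point_cvg Fm Fy.
  apply: cvgMl; apply: cvgD; first exact: family_point_cvg Fx0 Fy.
  exact: family_point_cvg Fx1 Fy.
apply: (cvgr_to_ge tcvg); apply: nearW => k.
have := fB k; rewrite /= => /negP; rewrite -ltNge.
rewrite -/(delta (f k)) [`|delta _|]ger0_norm// -rE => big.
have rk0 := normalizing_gt0 r k.
rewrite -mulrDl mulrAC -mulrBl ler_pdivlMr//.
move: big; rewrite /pos_part; set t := _ - _.
have ert : 0 < e * r k by exact: mulr_gt0.
(* The positive part equals [t] for [t >= 0] and 0 for [t < 0]; the latter cannot exceed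
   [e * r k]. *)
case: (ger0P t) => t0.
  by rewrite ger0_norm; lra.
by rewrite addNr mul0r normr0; lra.
Qed.
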